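(* Every Eulerian digraph $G$ on $n$ vertices, with $m$ edges and with maximum degree $\Delta$, contains a cycle of length $\Omega\left(\dfrac{m}{n\log\Delta}\right)$.
   Context: Digraphs are finite, without loops and without parallel edges; each edge is an ordered pair $(u,v)$ of distinct vertices, and both $(u,v)$ and $(v,u)$ may be present. $\mathrm{d}^+(v)$ and $\mathrm{d}^-(v)$ denote the out-degree and in-degree of $v$. The maximum degree of $G$ is $\Delta=\Delta(G):=\max_{v\in V(G)}\{\mathrm{d}^-(v),\mathrm{d}^+(v)\}$. A digraph is Eulerian if it is connected and $\mathrm{d}^+(v)=\mathrm{d}^-(v)$ for every vertex $v$. Cycles are directed cycles without repeated vertices (length $2$ is allowed); the length of a cycle is its number of edges. $\log$ is the natural logarithm. The constant implied by $\Omega(\cdot)$ is absolute and positive. *)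

(* Defs.v *)
From mathcomp Require Import all_boot.

Set Implicit Arguments.
Unset Strict Implicit.
Unset Printing Implicit Defensive.

(* Irreflexivity excludes loops; a relation cannot carry parallel edges, while
   both edge u v and edge v u may hold. *)
Record digraph := Digraph {
  vertex :> finType;
  edge : rel vertex;
  edge_irr : irreflexive edge
}.

Section Digraph.
Variable G : digraph.

Definition nvertices : nat := #|G|.

Definition edges : {set G * G} := [set p | edge p.1 p.2].

Definition outdeg (v : G) : nat := #|[set w | edge v w]|.

Definition indeg (v : G) : nat := #|[set u | edge u v]|.

Definition maxdeg : nat := \max_(v : G) maxn (indeg v) (outdeg v).

(* Connectedness of the underlying undirected graph. *)
Definition weakly_connected : Prop :=
  0 < #|G| /\
  forall u v : G, connect (fun x y => edge x y || edge y x) u v.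

Definition eulerian : Prop :=
  weakly_connected /\ forall v : G, outdeg v = indeg v.

(* A cycle is the nonempty list of its vertices in cyclic order, the last one
   being joined to the first, so that its number of edges is the size of the
   list. Size 1 would require a loop. *)
Definition dicycle (c : seq G) : bool :=
  [&& c != [::], uniq c & path.cycle (@edge G) c].

End Digraph.

(* Main.v *)
Require Import Defs.
From mathcomp Require Import all_boot all_order all_algebra.
From mathcomp Require Import boolp sequences.
From mathcomp Require Import reals exp.
From mathcomp Require Import ring lra zify.

Set Implicit Arguments.
Unset Strict Implicit.
Unset Printing Implicit Defensive.

Import Order.TTheory GRing.Theory Num.Theory.
Local Open Scope ring_scope.

(* Suppose that every cycle has length below s, a small multiple of
   m / (n ln Delta), and put Lam = m / (2 n), of order s ln Delta. Let p be a
   potential with values in {0, .., n}, of maximal sum among those for which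
   the sum of (p u + 1 - p v)^+ over the out-neighbours v of u is at most Lam
   whenever p u > 0. If p is positive everywhere, summing over all edges cancels
   p, because G is balanced, and gives m <= n Lam, which is absurd. Otherwise
   some value is missing from the range of p; on the set U of vertices below it,
   maximality makes the sum of (p u + 2 - p v)^+ over the out-neighbours v in U
   exceed Lam. Normalising these weights to sum 1 at every vertex of U, the
   potential cancels along cycles, so that a cycle C has weight less than
   2 |C| / Lam. This contradicts the existence of a cycle of weight at least
   c / ln Delta in any such weighting (heavy_cycle).

   For the latter, grow a path ending at u, together with the set H of vertices
   reachable from u off the path. When all cycles are light, an x in H has edges
   only to a final segment of the path of weight < eps. The weights out of u and
   the average, over any distribution on H, of the weights out of x in H are
   comparable measures on H, so u has an out-neighbour v whose edge from u
   weighs at least half the average weight lost to v. With the distribution given by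
   multiplicative weights (exponential in the weight lost so far), no x in H ever
   loses more than half of its out-weight to the path, so the path never gets
   stuck although H keeps shrinking. *)

(** * Exponential estimates *)

Section ExpM1.
Variables (R : realType) (lam : R).
Hypothesis lam_gt0 : 0 < lam.

Definition expm1 (y : R) : R := expR (lam * y) - 1.

Lemma expm1_0 : expm1 0 = 0.
Proof. by rewrite /expm1 mulr0 expR0 subrr. Qed.

Lemma expm1_ge0 y : 0 <= y -> 0 <= expm1 y.
Proof.
by move=> y0; rewrite subr_ge0 -expR0 ler_expR mulr_ge0 // ltW.
Qed.

Lemma expm1_le x y : x <= y -> expm1 x <= expm1 y.
Proof. by move=> xy; rewrite lerB // ler_expR ler_pM2l. Qed.

(** Convexity of [expm1], which vanishes at 0: the tangent of the exponential at [b] lies below it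
    both at [a] and at 0. *)
Lemma expm1_scale (s y : R) :
  0 <= s <= 1 -> expm1 ((1 - s) * y) <= (1 - s) * expm1 y.
Proof.
move=> /andP[s0 s1]; rewrite /expm1.
set a := lam * y; rewrite (_ : lam * _ = (1 - s) * a); last by rewrite /a; ring.
set b := (1 - s) * a.
have Eb0 : 0 < expR b by exact: expR_gt0.
have h1 : expR b * (1 + (a - b)) <= expR a.
  rewrite (_ : expR a = expR b * expR (a - b)); last by rewrite -expRD; congr expR; ring.
  by rewrite ler_pM2l // expR_ge1Dx.
have h2 : expR b * (1 + (- b)) <= 1.
  rewrite -{2}expR0 (_ : expR 0 = expR b * expR (- b)); last by rewrite -expRD subrr.
  by rewrite ler_pM2l // expR_ge1Dx.
have h3 : (1 - s) * (expR b * (1 + (a - b))) <= (1 - s) * expR a.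
  by rewrite ler_wpM2l // subr_ge0.
have h4 : s * (expR b * (1 + (- b))) <= s * 1 by rewrite ler_wpM2l.
suff : expR b = (1 - s) * (expR b * (1 + (a - b))) + s * (expR b * (1 - b)) by lra.
by rewrite /b; ring.
Qed.

Lemma expm1_add (a b : R) : 0 <= b -> lam * b <= 2^-1 ->
  expm1 (a + b) <= expm1 a + (expm1 a + 1) * (2 * (lam * b)).
Proof.
move=> b0 bh; rewrite /expm1 mulrDr expRD subrK.
set c := lam * b; have c0 : 0 <= c by rewrite mulr_ge0 // ltW.
have Ea : 0 < expR (lam * a) by exact: expR_gt0.
have : expR c <= 1 + 2 * c.
  have h : (1 - c) * expR c <= 1.
    have := expR_ge1Dx (- c); have := expR_gt0 c; have := expRxMexpNx_1 c; nra.
  have := expR_gt0 c; rewrite -/c in bh; nra.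
by move=> h; have := ler_wpM2l (ltW Ea) h; lra.
Qed.

End ExpM1.

(** * Weight of a path *)

Section PathWeight.
Variables (R : realType) (T : Type) (P : T -> T -> R).

Fixpoint pathw (x : T) (s : seq T) : R :=
  if s is y :: s' then P x y + pathw y s' else 0.

Lemma pathw_cat x s t : pathw x (s ++ t) = pathw x s + pathw (last x s) t.
Proof. by elim: s x => [|y s IH] x /=; rewrite ?add0r // IH addrA. Qed.

Lemma pathw_rcons x s y : pathw x (rcons s y) = pathw x s + P (last x s) y.
Proof. by rewrite -cats1 pathw_cat /= addr0. Qed.

Lemma pathw_ge0 x s : (forall a b, 0 <= P a b) -> 0 <= pathw x s.
Proof. by move=> P0; elim: s x => //= y s IH x; rewrite addr_ge0. Qed.

End PathWeight.

(** * Heavy cycles in a weighted digraph *)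

Section HeavyCycle.
Variables (R : realType) (T : finType) (P : T -> T -> R).
Variables (U : {set T}) (lam beta D : R).
Hypothesis lam_gt0 : 0 < lam.
Hypothesis P_ge0 : forall x y, 0 <= P x y.
Hypothesis P_diag : forall x, P x x = 0.
Hypothesis P_row : forall x, x \in U -> \sum_y P x y = 1.
Hypothesis P_closed : forall x y, x \in U -> 0 < P x y -> y \in U.
Hypothesis P_min : forall x y, 0 < P x y -> beta <= P x y.
Hypothesis P_col : forall y, \sum_x P x y <= D.

Let eps : R := (32 * lam)^-1.
(** This is [expm1 lam] at 1/2, so a potential of at most [A] keeps every loss at most 1/2. *)
Let A : R := expR (lam / 2) - 1.
Hypothesis A_beta : D <= 2 * beta * A.
Hypothesis A_lam : 4 * lam * D <= A.

Definition pos : rel T := fun x y => 0 < P x y.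

Hypothesis light : forall r s,
  path pos r (rcons s r) -> uniq (r :: s) -> pathw P r (rcons s r) < eps.

Let eps_gt0 : 0 < eps. Proof. by rewrite invr_gt0 mulr_gt0. Qed.

Let lam_eps : lam * eps = 32^-1.
Proof. by rewrite /eps invfM mulrCA divff ?mulr1 // gt_eqF. Qed.

(* K is the vertex set of the path, u its end, and delta r is the weight of the
   part of the path from r to u. *)
Record frontier (K H : {set T}) (u : T) (delta : T -> R) : Prop := Frontier {
  fr_end : u \in K;
  fr_disj : forall x, x \in H -> x \notin K;
  fr_sub : H \subset U;
  fr_closed : forall x y, x \in H -> 0 < P x y -> (y \in H) || (y \in K);
  fr_path : forall r, r \in K -> exists s, [/\ path pos r s, last r s = u,
     uniq (r :: s), {subset s <= K} & pathw P r s = delta r];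
  fr_reach : forall x, x \in H -> exists t, [/\ path pos u t, last u t = x,
     uniq t & {in t, forall y, y \notin K}];
  fr_out : 2^-1 <= \sum_(y in H) P u y
}.

(** The path from [r] to [u], a path from [u] to [x] off [K] and the edge from [x] to [r] form a
    cycle, hence a light one. *)
Lemma frontier_close K H u delta x r : frontier K H u delta ->
  x \in H -> r \in K -> 0 < P x r -> delta r + P x r < eps.
Proof.
move=> [uK dis _ _ Hp Hr _] xH rK Pxr.
have [s [ps ls us sK <-]] := Hp r rK.
have [t [pt lt ut tK]] := Hr x xH.
have pc : path pos r (rcons (s ++ t) r).
  by rewrite rcons_path cat_path ps ls pt last_cat ls lt.
have uc : uniq (r :: s ++ t).
  rewrite -cat_cons cat_uniq us ut andbT /=; apply/hasPn => y yt.
  have yK := tK y yt; rewrite inE; apply/norP; split.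
    by apply: contraNneq yK => ->.
  by apply: contraNN yK => /sK.
have := light pc uc.
rewrite pathw_rcons pathw_cat last_cat ls lt.
by have := pathw_ge0 u t P_ge0; lra.
Qed.

(** [H'] is what [v] reaches inside [H :\ v]. At most half of the out-weight of [v] goes to [K]; the
    rest stays in [H'], whence [fr_out]. *)
Lemma frontier_extend (K H : {set T}) v (delta : T -> R) :
  v \in H -> (forall x, x \in H -> x \notin K) -> H \subset U ->
  (forall x y, x \in H -> 0 < P x y -> (y \in H) || (y \in K)) ->
  (forall r, r \in K -> exists s, [/\ path pos r s, last r s = v,
     uniq (r :: s), {subset s <= v |: K} & pathw P r s = delta r]) ->
  \sum_(r in K) P v r <= 2^-1 ->
  exists2 H' : {set T}, H' \subset H :\ v &
    frontier (v |: K) H' v (fun r => if r == v then 0 else delta r).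
Proof.
move=> vH dis HU cl Hp loss.
pose e : rel T := fun a b => (0 < P a b) && (b \in H :\ v).
exists [set x in H :\ v | connect e v x].
  by apply/subsetP => x; rewrite inE => /andP[].
have vK : v \notin K by exact: dis.
have conn_step x y : (x \in H) -> connect e v x -> 0 < P x y ->
    (y \in [set x in H :\ v | connect e v x]) || (y \in v |: K).
  move=> xH cx Pxy; rewrite !inE.
  have /orP[yH|yK] := cl x y xH Pxy; last by rewrite yK !orbT.
  have [//|yv] := eqVneq y v.
  rewrite yH /= (connect_trans cx) //; apply: connect1.
  by rewrite /e Pxy !inE yv yH.
split.
- by rewrite !inE eqxx.
- move=> x; rewrite !inE => /andP[/andP[xv xH] _]; rewrite negb_or xv /=.
  exact: dis.
- apply: subset_trans HU; apply/subsetP => x; rewrite !inE.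
  by case/andP => /andP[].
- by move=> x y; rewrite inE => /andP[]; rewrite !inE => /andP[_ xH] cx;
    have := @conn_step x y xH cx; rewrite !inE.
- move=> r; have [-> _|rv] := eqVneq r v.
    by exists [::]; split=> //=; rewrite eqxx.
  by rewrite !inE (negPf rv) /= => /Hp.
- move=> x; rewrite inE => /andP[xH /connectP[t0 pt0 ->]].
  case: (shortenP pt0) => t pt ut _; exists t.
  have tH : {in t, forall y, y \in H :\ v}.
    suff h w : path e w t -> {in t, forall y, y \in H :\ v} by exact: h pt.
    elim: t w {pt ut} => //= a t IH w /andP[/andP[_ aH] /IH h] y.
    by rewrite inE => /orP[/eqP->|/h].
  split=> //.
  + by apply: sub_path pt => a b /andP[].
  + by case/andP: ut.
  + move=> y /tH; rewrite !inE => /andP[yv yH]; rewrite negb_or yv /=.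
    exact: dis.
- have /P_row : v \in U by exact: (subsetP HU).
  rewrite (bigID (mem K)) /= => E.
  suff : \sum_(i | i \notin K) P v i <=
         \sum_(y in [set x in H :\ v | connect e v x]) P v y by lra.
  rewrite [leLHS](bigID (mem [set x in H :\ v | connect e v x])) /=.
  rewrite [X in _ + X]big1 ?addr0.
    by rewrite [leRHS]big_mkcond [leLHS]big_mkcond ler_sum // => i _;
      case: (i \in K); case: ifP.
  move=> i /andP[iK iH]; apply/eqP; rewrite eq_le P_ge0 andbT leNgt.
  apply/negP => Pvi; have := conn_step v i vH (connect0 _ _) Pvi.
  rewrite (negPf iH) /= !inE (negPf iK) orbF => /eqP iv.
  by rewrite iv P_diag ltxx in Pvi.
Qed.

(* For the edges that matter delta r < eps, so the factor lies in [1, 2]. Its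
   decrease as the path grows forgets old losses, and this outweighs the growth
   due to new ones: the potential stays bounded on arbitrarily long paths. *)
Definition dloss (K : {set T}) (delta : T -> R) x : R :=
  \sum_(r in K) P x r * (2 - delta r / eps).

Definition potential (K H : {set T}) (delta : T -> R) : R :=
  \sum_(x in H) expm1 lam (dloss K delta x).

Let A_ge0 : 0 <= A.
Proof.
rewrite subr_ge0; apply: le_trans (expR_ge1Dx _).
by rewrite lerDl divr_ge0 // ltW.
Qed.

(** An edge from [x] to [r] forces [delta r < eps], so its factor is at least 1. *)
Lemma loss_le_dloss K H u delta x : frontier K H u delta -> x \in H ->
  \sum_(r in K) P x r <= dloss K delta x.
Proof.
move=> fr xH; apply: ler_sum => r rK.
have := P_ge0 x r; rewrite le_eqVlt => /orP[/eqP<-|Pxr]; first by rewrite mul0r.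
rewrite -{1}(mulr1 (P x r)) ler_pM2l //.
have : delta r / eps <= 1.
  by rewrite ler_pdivrMr // mul1r; have := frontier_close fr xH rK Pxr; lra.
by lra.
Qed.

Lemma dloss_ge0 K H u delta x : frontier K H u delta -> x \in H ->
  0 <= dloss K delta x.
Proof.
by move=> fr xH; apply: le_trans (loss_le_dloss fr xH); rewrite sumr_ge0.
Qed.

Lemma frontier_loss K H u delta x : frontier K H u delta ->
  potential K H delta <= A -> x \in H -> \sum_(r in K) P x r <= 2^-1.
Proof.
move=> fr pot xH; apply: le_trans (loss_le_dloss fr xH) _.
have : expm1 lam (dloss K delta x) <= A.
  apply: le_trans pot; rewrite /potential (bigD1 x) //= lerDl sumr_ge0 // => y.
  by case/andP => yH _; apply: expm1_ge0 => //; apply: dloss_ge0 fr yH.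
by rewrite /expm1 /A lerD2r ler_expR ler_pM2l.
Qed.

(** Averaging: if every [v] failed, summing over [H] would give a contradiction, since rows sum to 1
    while [u] sends at least 1/2 into [H]. *)
Lemma frontier_next K H u delta : frontier K H u delta ->
  exists v, [/\ v \in H, 0 < P u v &
    \sum_(x in H) expm1 lam (dloss K delta x) * P x v
      <= 2 * potential K H delta * P u v].
Proof.
move=> fr; apply: contrapT => none.
set f := fun x => expm1 lam (dloss K delta x).
have f0 x : x \in H -> 0 <= f x.
  by move=> xH; apply: expm1_ge0 => //; apply: dloss_ge0 fr xH.
have big v : v \in H -> 0 < P u v ->
    2 * potential K H delta * P u v < \sum_(x in H) f x * P x v.
  move=> vH Puv; rewrite ltNge; apply/negP => h; apply: none.
  by exists v; split.
have out := fr_out fr.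
(* One actual edge makes the summed inequality strict even if the potential is 0. *)
have [v0 v0H Puv0] : exists2 v, v \in H & 0 < P u v.
  apply: contrapT => h.
  suff E : \sum_(y in H) P u y = 0 by rewrite E in out; lra.
  apply: big1 => y yH; apply/eqP; rewrite eq_le P_ge0 andbT leNgt.
  by apply/negP => Puy; apply: h; exists y.
have : \sum_(v in H) 2 * potential K H delta * P u v <
       \sum_(v in H) \sum_(x in H) f x * P x v.
  rewrite [ltLHS](bigD1 v0) //= [ltRHS](bigD1 v0) //= ltr_leD ?big //.
  apply: ler_sum => v /andP[vH _].
  have := P_ge0 u v; rewrite le_eqVlt => /orP[/eqP<-|]; last by move/(big _ vH)/ltW.
  by rewrite mulr0 sumr_ge0 // => x xH; rewrite mulr_ge0 ?f0.
rewrite exchange_big /= -mulr_sumr => lt1.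
have : \sum_(x in H) \sum_(v in H) f x * P x v <= potential K H delta.
  apply: ler_sum => x xH; rewrite -mulr_sumr -[leRHS]mulr1.
  rewrite ler_wpM2l ?f0 // -(P_row (subsetP (fr_sub fr) x xH)).
  by rewrite [leRHS](bigID (mem H)) /= lerDl sumr_ge0.
have : 0 <= potential K H delta by apply: sumr_ge0 => x; exact: f0.
by nra.
Qed.

(** The vertex [v] enters with factor 2, so the exponent grows by [2 * lam * P x v], below 1/16 by
    [frontier_close]. *)
Lemma expm1_dloss_extend (K H' : {set T}) v delta delta' x :
  v \notin K -> frontier (v |: K) H' v delta' -> delta' v = 0 ->
  {in K, delta' =1 delta} -> x \in H' ->
  expm1 lam (dloss (v |: K) delta' x) <=
    expm1 lam (dloss K delta x) +
    (expm1 lam (dloss K delta x) + 1) * (4 * lam * P x v).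
Proof.
move=> vK fr d0 dK xH'.
rewrite /dloss big_setU1 //= d0 mul0r subr0 addrC.
rewrite (eq_bigr (fun r => P x r * (2 - delta r / eps))); last first.
  by move=> r rK; rewrite dK.
rewrite (_ : 4 * lam * P x v = 2 * (lam * (P x v * 2))); last by ring.
have P0 := P_ge0 x v.
apply: expm1_add => //; first by rewrite mulr_ge0.
have := P0; rewrite le_eqVlt => /orP[/eqP<-|Pxv].
  by rewrite mul0r mulr0 invr_ge0.
have := frontier_close fr xH' (setU11 _ _) Pxv; rewrite d0 add0r => lt.
have : lam * P x v < lam * eps by rewrite ltr_pM2l.
by rewrite lam_eps; lra.
Qed.

Lemma sum_col_le (H : {set T}) v :
  \sum_(x in H) 4 * lam * P x v <= 4 * lam * D.
Proof.
rewrite -mulr_sumr; apply: ler_wpM2l; first by rewrite mulr_ge0 // ltW.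
apply: le_trans (P_col v).
by rewrite [leRHS](bigID (mem H)) /= lerDl sumr_ge0.
Qed.

(** Serves the start and every restart: only [v] contributes, and [A_lam] pays for its column. *)
Lemma potential_fresh (K H' : {set T}) v delta' :
  v \notin K -> frontier (v |: K) H' v delta' -> delta' v = 0 ->
  (forall x r, x \in H' -> r \in K -> P x r = 0) ->
  potential (v |: K) H' delta' <= A.
Proof.
move=> vK fr d0 P0.
apply: le_trans A_lam.
apply: (@le_trans _ _ (\sum_(x in H') 4 * lam * P x v)); last first.
  exact: sum_col_le.
apply: ler_sum => x xH'.
have := expm1_dloss_extend vK fr d0 (fun _ _ => erefl) xH'.
rewrite {2 3}/dloss big1; first by rewrite expm1_0 !add0r mul1r.
by move=> r rK; rewrite P0 ?mul0r.
Qed.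

Lemma frontier_step K H u delta : frontier K H u delta ->
  potential K H delta <= A ->
  exists K' (H' : {set T}) u' delta', [/\ H' \proper H, frontier K' H' u' delta' &
    potential K' H' delta' <= A].
Proof.
move=> fr pot.
have [v [vH Puv le2]] := frontier_next fr.
have vK : v \notin K := fr_disj fr vH.
set w := P u v in Puv le2.
pose d1 r := delta r + w.
have d_ge0 r : r \in K -> 0 <= delta r.
  by move=> /(fr_path fr)[s [_ _ _ _ <-]]; exact: pathw_ge0.
have [|H' H'H fr'] := frontier_extend (delta := d1) vH (fr_disj fr) (fr_sub fr)
    (fr_closed fr) _ (frontier_loss fr pot vH).
  move=> r rK; have [s [ps ls us sK ws]] := fr_path fr rK.
  exists (rcons s v); split.
  - by rewrite rcons_path ps ls.
  - by rewrite last_rcons.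
  - rewrite -rcons_cons rcons_uniq us andbT inE negb_or.
    by rewrite (contraNneq _ vK) => [|->//]; apply: contraNN vK => /sK.
  - move=> y; rewrite mem_rcons !inE => /orP[->//|/sK ->]; exact: orbT.
  - by rewrite pathw_rcons ls ws.
set d' := (fun r => _) in fr'.
have d'v : d' v = 0 by rewrite /d' eqxx.
have d'K : {in K, d' =1 d1}.
  by move=> r rK; rewrite /d'; case: eqVneq => // E; rewrite -E rK in vK.
exists (v |: K), H', v, d'; split=> //.
  by apply: sub_proper_trans H'H (properD1 vH).
have close x r : x \in H' -> r \in K -> 0 < P x r -> delta r + w < eps.
  move=> xH' rK Pxr; have := frontier_close fr' xH' (setU1r _ rK) Pxr.
  by rewrite d'K // /d1; lra.
(* If the new edge weighs at least [eps], the old path is too far back to receive an edge from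
   [H']. *)
have [weps|epsw] := ltP w eps; last first.
  apply: potential_fresh => // x r xH' rK.
  apply/eqP; rewrite eq_le P_ge0 andbT leNgt; apply/negP => Pxr.
  by have := close x r xH' rK Pxr; have := d_ge0 r rK; lra.
have H'subH : H' \subset H by apply: subset_trans H'H (subsetDl _ _).
set f := fun x => expm1 lam (dloss K delta x).
have f0 x : x \in H -> 0 <= f x.
  by move=> xH; apply: expm1_ge0 => //; apply: dloss_ge0 fr xH.
(* Each factor drops by [w / eps]; being at most 2, it loses at least [s = w / (2 * eps)] times its
   value. *)
pose s := 16 * lam * w.
have lw : lam * w < 32^-1 by rewrite -lam_eps ltr_pM2l.
have lw0 : 0 < lam * w by rewrite mulr_gt0.
have step x : x \in H' -> expm1 lam (dloss (v |: K) d' x) <=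
    (1 - s) * f x + f x * (4 * lam * P x v) + 4 * lam * P x v.
  move=> xH'; have xH := subsetP H'subH x xH'.
  apply: le_trans (expm1_dloss_extend vK fr' d'v d'K xH') _.
  have le1 : expm1 lam (dloss K d1 x) <= (1 - s) * f x.
    apply: le_trans (expm1_scale lam _ (s := s) _); last by rewrite /s; lra.
    apply: expm1_le => //; rewrite /dloss mulr_sumr; apply: ler_sum => r rK.
    rewrite mulrCA; apply: ler_wpM2l => //.
    have -> : s = w / eps / 2 by rewrite /s /eps invrK; field.
    rewrite /d1 mulrDl.
    have : 0 <= delta r / eps by rewrite divr_ge0 ?d_ge0 // ltW.
    have : 0 <= w / eps by rewrite divr_ge0 // ltW.
    by nra.
  have s0 : 0 <= s * f x by rewrite mulr_ge0 ?f0 // /s; lra.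
  have l0 : 0 <= 4 * lam * P x v by rewrite !mulr_ge0 // ltW.
  have le2' : expm1 lam (dloss K d1 x) <= f x by lra.
  have := ler_wpM2r l0 le2'; lra.
have pot0 : 0 <= potential K H delta by apply: sumr_ge0 => x; exact: f0.
have s1 : 0 <= 1 - s by rewrite /s; lra.
have subsum (F : T -> R) : (forall x, x \in H -> 0 <= F x) ->
    \sum_(x in H') F x <= \sum_(x in H) F x.
  move=> F0; rewrite [leRHS](big_setID H') /= (setIidPr H'subH) lerDl.
  by apply: sumr_ge0 => x; rewrite inE => /andP[_ /F0].
have t1 : \sum_(x in H') (1 - s) * f x <= (1 - s) * potential K H delta.
  by rewrite -mulr_sumr; apply: ler_wpM2l => //; apply: subsum.
have t2 : \sum_(x in H') f x * (4 * lam * P x v) <=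
    8 * lam * potential K H delta * w.
  apply: (@le_trans _ _ (4 * lam * \sum_(x in H) f x * P x v)); last first.
    have := ler_wpM2l (ltW lam_gt0) le2; rewrite -/f; lra.
  rewrite mulr_sumr; under [leRHS]eq_bigr do rewrite mulrCA.
  by apply: subsum => x xH; rewrite mulr_ge0 ?f0 // !mulr_ge0 // ltW.
have t3 := sum_col_le H' v.
apply: le_trans; first by apply: ler_sum => x xH'; exact: step xH'.
rewrite !big_split /=.
(* As [w >= beta], the column term is at most [8 * lam * w * A], and the bound becomes a convex
   combination of the old potential and [A]. *)
have : D <= 2 * w * A.
  by apply: le_trans A_beta _; rewrite ler_wpM2r // ler_pM2l // P_min.
move=> DA; have := ler_wpM2l (ltW lam_gt0) DA.
have : (1 - 8 * (lam * w)) * potential K H delta <= (1 - 8 * (lam * w)) * A.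
  by rewrite ler_wpM2l //; lra.
by rewrite /s in t1 *; lra.
Qed.

Lemma no_frontier K H u delta : frontier K H u delta ->
  potential K H delta <= A -> False.
Proof.
have [n] := ubnP #|H|; elim: n => // n IH in K H u delta *.
rewrite ltnS => Hn fr /(frontier_step fr)[K' [H' [u' [d' [H'H fr' pot']]]]].
exact: IH (leq_trans (proper_card H'H) Hn) fr' pot'.
Qed.

(** A vertex of [U] would start a path, as an extension of the empty one. *)
Lemma light_set0 : U = set0.
Proof.
have [//|[x0 x0U]] := set_0Vmem U.
have [||x y xU Pxy|r||H' _ fr] := @frontier_extend set0 U x0 (fun=> 0) x0U.
- by move=> x _; rewrite inE.
- exact: subxx.
- by rewrite (P_closed xU Pxy).
- by rewrite inE.
- by rewrite big_set0 invr_ge0.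
have x00 : x0 \notin set0 by rewrite inE.
case: (no_frontier fr); apply: potential_fresh x00 fr _ _; first by rewrite eqxx.
by move=> x r _; rewrite inE.
Qed.

End HeavyCycle.

Lemma heavy_cycle (R : realType) (T : finType) (P : T -> T -> R) (U : {set T})
    (lam beta D : R) :
  0 < lam ->
  (forall x y, 0 <= P x y) -> (forall x, P x x = 0) ->
  (forall x, x \in U -> \sum_y P x y = 1) ->
  (forall x y, x \in U -> 0 < P x y -> y \in U) ->
  (forall x y, 0 < P x y -> beta <= P x y) ->
  (forall y, \sum_x P x y <= D) ->
  D <= 2 * beta * (expR (lam / 2) - 1) ->
  4 * lam * D <= expR (lam / 2) - 1 ->
  U != set0 ->
  exists r s, [/\ path (fun x y => 0 < P x y) r (rcons s r), uniq (r :: s) &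
    (32 * lam)^-1 <= pathw P r (rcons s r)].
Proof.
move=> l0 P0 Pd Pr Pc Pm PD Db Dl /eqP U0; apply: contrapT => none.
apply: U0; apply: (light_set0 l0 P0 Pd Pr Pc Pm PD Db Dl) => r s prs urs.
by rewrite ltNge; apply/negP => h; apply: none; exists r, s.
Qed.

(** * Potentials of maximal sum *)

Section Heights.
Variable G : digraph.

(** Truncated subtraction is the positive part. The case [k = 2] bounds the case [k = 1] after [p u]
    is raised by 1. *)
Definition excess (k : nat) (p : G -> nat) (u : G) : nat :=
  (\sum_(v | edge u v) (p u + k - p v))%N.

Lemma sum_edges (F : G -> G -> nat) :
  (\sum_(e in edges G) F e.1 e.2 = \sum_u \sum_(v | edge u v) F u v)%N.
Proof.
rewrite pair_big_dep /=; apply: eq_bigl => -[u v]; exact: in_set.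
Qed.

(** By balance each vertex is as often a tail as a head, so [p] cancels over the edges; truncation
    only adds. *)
Lemma card_edges_le (p : G -> nat) : (forall v : G, outdeg v = indeg v) ->
  (#|edges G| <= \sum_u excess 1 p u)%N.
Proof.
move=> bal.
have E : (\sum_(e in edges G) p e.1 = \sum_(e in edges G) p e.2)%N.
  rewrite (sum_edges (fun u _ => p u)) (sum_edges (fun _ v => p v)).
  rewrite [RHS](exchange_big_dep predT) //=.
  apply: eq_bigr => u _; rewrite !sum_nat_cond_const; congr (_ * _)%N.
  exact: bal.
rewrite -(leq_add2r (\sum_(e in edges G) p e.2)) -{1}E -sum1_card -big_split /=.
rewrite -(sum_edges (fun u v => (p u + 1 - p v)%N)) -big_split /=.
by apply: leq_sum => -[u v] _ /=; rewrite addnC [leqRHS]addnC -leq_subLR.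
Qed.

Lemma exists_heights (ok : pred nat) :
  (forall a b, (a <= b)%N -> ok b -> ok a) ->
  (exists p, forall u, ok (excess 1 p u)) \/
  exists (p : G -> nat) (U : {set G}), U != set0 /\ forall u, u \in U ->
    ~~ ok (\sum_(v in U | edge u v) (p u + 2 - p v))%N /\
    (p u == 0%N) || ok (excess 1 p u).
Proof.
move=> ok_le; set n := #|G|.
pose feas (f : {ffun G -> 'I_n.+1}) :=
  [forall u, (f u == 0 :> nat) || ok (excess 1 (fun v => f v) u)].
have feas0 : feas [ffun=> ord0] by apply/forallP => u; rewrite ffunE.
case: (arg_maxnP (fun f : {ffun G -> 'I_n.+1} => \sum_u f u)%N feas0).
move=> p /forallP feasp maxp.
(* Otherwise raising [p u] by 1 would stay feasible and increase the sum. *)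
have raise u : (p u < n)%N -> ~~ ok (excess 2 (fun v => p v) u).
  move=> pun; apply/negP => oku.
  pose p1 : {ffun G -> 'I_n.+1} := [ffun v => if v == u then inord (p u).+1 else p v].
  have p1u : p1 u = (p u).+1 :> nat by rewrite ffunE eqxx inordK.
  have p1v v : v != u -> p1 v = p v by move=> vu; rewrite ffunE (negPf vu).
  have p_le v : (p v <= p1 v)%N.
    by have [->|/p1v ->//] := eqVneq v u; rewrite p1u.
  have feas1 : feas p1.
    apply/forallP => v; have [->|vu] := eqVneq v u.
      apply/orP; right; apply: ok_le oku; apply: leq_sum => w uw.
      by rewrite p1u addSnnS leq_sub2l.
    rewrite p1v //; have /orP[->//|okv] := feasp v.
    apply/orP; right; apply: ok_le okv; apply: leq_sum => w vw.
    by rewrite p1v // leq_sub2l.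
  have /= := maxp _ feas1; rewrite /geq /= leqNgt => /negP; apply.
  by rewrite (bigD1 u) //= [ltnRHS](bigD1 u) //= -addSn leq_add ?p1u // leq_sum.
have [/existsP[u0 /eqP pu0]|/existsPn pos0] := boolP [exists u, p u == 0 :> nat];
  last first.
  left; exists (fun v => nat_of_ord (p v)) => u.
  by have := feasp u; rewrite (negPf (pos0 u)).
right; exists (fun v => nat_of_ord (p v)).
(* There are [n + 1] values for [n] vertices; the missed one is not 0, which [u0] takes. *)
have [t [tn gap]] : exists t, (t < n)%N /\ forall v, p v != t.+1 :> nat.
  have [k /forallP kP] : exists k : 'I_n.+1, [forall v, p v != k].
    apply/existsP; apply: contraT; rewrite negb_exists => /forallP full.
    suff : (n.+1 <= n)%N by rewrite ltnn.
    rewrite -{1}(card_ord n.+1) -cardsT.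
    apply: (@leq_trans #|p @: [set: G]|); last first.
      by have := leq_imset_card p [set: G]; rewrite [#|[set: G]|]cardsT.
    apply/subset_leq_card/subsetP => k _.
    have := full k; rewrite negb_forall => /existsP[v]; rewrite negbK => /eqP <-.
    exact: imset_f.
  have k0 : (0 < k)%N.
    by rewrite lt0n; apply: contraNneq (kP u0) => k0; rewrite -val_eqE /= pu0 k0.
  exists k.-1; rewrite prednK //; split; last by move=> v; exact: kP.
  by rewrite -ltnS.
exists [set u | p u <= t]%N; split.
  by apply/set0Pn; exists u0; rewrite inE pu0.
move=> u; rewrite inE => put; split; last exact: feasp.
have := raise u (leq_ltn_trans put tn); rewrite /excess.
rewrite (bigID (fun v => v \in [set u | p u <= t]%N)) /=.
(* Outside the set the potential is at least [t + 2], as [t + 1] is missed, so these terms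
   vanish. *)
rewrite [X in ok (_ + X)%N]big1 ?addn0 => [|v /andP[_]].
  by rewrite (eq_bigl _ _ (fun v => andbC (edge u v) _)).
rewrite inE -ltnNge => ltv; apply/eqP; rewrite subn_eq0 addn2.
by apply: (@leq_ltn_trans t.+1) => //; rewrite ltn_neqAle eq_sym gap.
Qed.

End Heights.

(** * Choice of the weights and constants *)

(* For maxdeg G <= 1 the quantity m / (n log maxdeg) is undefined. *)
Theorem corollary1p9 (R : realType) :
  exists2 K : R, 0 < K &
    forall G : digraph, eulerian G -> (1 < maxdeg G)%N ->
      exists2 c : seq G, dicycle c &
        K * (#|edges G|%:R / ((nvertices G)%:R * ln (maxdeg G)%:R))
          <= (size c)%:R.
Proof.
(* This is 640 * 2 * 2: from [32 * lam = 640 * ln Delta], the cycle weight bound [2 * |C| / Lam],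
   and [Lam = m / (2 * n)]. *)
exists 2560^-1; first by rewrite invr_gt0.
move=> G [_ bal] Delta_gt1; set Delta := maxdeg G in Delta_gt1 *.
have outD (u : G) : (outdeg u <= Delta)%N.
  apply: leq_trans (leq_maxr (indeg u) _) _.
  exact: (leq_bigmax (F := fun v : G => maxn (indeg v) (outdeg v))).
have inD (u : G) : (indeg u <= Delta)%N by rewrite -bal.
set m := #|edges G|; set n := nvertices G.
have mE : m = (\sum_(u : G) outdeg u)%N.
  rewrite /m -sum1_card (sum_edges (fun _ _ => 1%N)).
  by apply: eq_bigr => u _; rewrite sum1dep_card.
have m_gt0 : (0 < m)%N.
  rewrite mE lt0n sum_nat_eq0; apply/negP => /forallP d0.
  suff : (Delta <= 0)%N by rewrite leqNgt (ltn_trans _ Delta_gt1).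
  by apply/bigmax_leqP => u _; rewrite -bal maxnn; have := d0 u; rewrite implyTb => /eqP ->.
have m_le : (m <= n * Delta)%N.
  by rewrite mE -sum_nat_const leq_sum // => u _; exact: outD.
have n_gt0 : (0 < n)%N by move: (leq_trans m_gt0 m_le); rewrite muln_gt0 => /andP[].
have d2 : 2 <= Delta%:R :> R by rewrite ler_nat.
have lnD : 0 < ln Delta%:R :> R by rewrite ln_gt0 // (ltr_nat R 1).
have nR : 0 < n%:R :> R by rewrite ltr0n.
have mR : 0 < m%:R :> R by rewrite ltr0n.
pose Lam : R := m%:R / (2 * n%:R).
have Lam_gt0 : 0 < Lam by rewrite divr_gt0 // mulr_gt0.
have LamD : Lam <= Delta%:R.
  rewrite /Lam ler_pdivrMr ?mulr_gt0 //.
  have : m%:R <= n%:R * Delta%:R :> R by rewrite -natrM ler_nat.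
  have : 0 <= n%:R * Delta%:R :> R by rewrite -natrM.
  lra.
apply: contrapT => short.
have {}short (c : seq G) : dicycle c -> 1280 * ln Delta%:R * (size c)%:R < Lam.
  move=> cyc; rewrite ltNge; apply/negP => h; apply: short; exists c => //.
  have -> : 2560^-1 * (m%:R / (n%:R * ln Delta%:R)) = Lam / (1280 * ln Delta%:R) :> R.
    by rewrite /Lam; field; rewrite !gt_eqF.
  by rewrite ler_pdivrMr ?mulr_gt0 // mulrC.
have ok_le (a b : nat) : (a <= b)%N -> b%:R <= Lam -> a%:R <= Lam.
  by move=> ab; apply: le_trans; rewrite ler_nat.
have [[p okp]|[p [U [U0 pU]]]] := @exists_heights G (fun k => k%:R <= Lam) ok_le.
  have := card_edges_le p bal; rewrite -(ler_nat R) -/m => mle.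
  have : m%:R <= n%:R * Lam.
    apply: le_trans mle _; rewrite natr_sum mulr_natl -sumr_const.
    exact: ler_sum.
  rewrite (_ : n%:R * Lam = m%:R / 2); first by lra.
  by rewrite /Lam; field; rewrite gt_eqF.
pose S u := (\sum_(v in U | edge u v) (p u + 2 - p v))%N.
have S_gt u : u \in U -> Lam < (S u)%:R by move=> /pU[]; rewrite -ltNge.
(* Replacing 2 by 1 costs at most the out-degree; the excess left is at most [Lam], or the
   out-degree if [p u = 0]. *)
have S_le u : u \in U -> (S u)%:R <= 2 * Delta%:R :> R.
  move=> uU; have [_ bd] := pU u uU.
  have : (S u <= excess 1 p u + outdeg u)%N.
    rewrite /outdeg -sum1dep_card -big_split /=.
    apply: (@leq_trans (\sum_(v | edge u v) (p u + 2 - p v))%N).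
      by rewrite /S [leqRHS](bigID (mem U)) /= (eq_bigl _ _ (fun v => andbC (v \in U) _)) leq_addr.
    apply: leq_sum => v _; lia.
  rewrite -(ler_nat R) natrD => Sle.
  have : (outdeg u)%:R <= Delta%:R :> R by rewrite ler_nat.
  suff : (excess 1 p u)%:R <= Delta%:R :> R by lra.
  case/orP: bd => [/eqP pu0|/le_trans]; last exact.
  rewrite ler_nat; apply: leq_trans (outD u).
  rewrite /outdeg -sum1dep_card; apply: leq_sum => v _; rewrite pu0; lia.
pose P u v : R := if [&& u \in U, v \in U & edge u v]
  then (p u + 2 - p v)%:R / (S u)%:R else 0.
have Pge0 u v : 0 <= P u v by rewrite /P; case: ifP => // _; rewrite divr_ge0.
have P_pos u v : 0 < P u v ->
    [/\ u \in U, v \in U, edge u v & (0 < p u + 2 - p v)%N].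
  rewrite /P; case: ifP => [/and3P[uU vU uv]|_]; last by rewrite ltxx.
  by case: posnP => [->|//]; rewrite mul0r ltxx.
have P_edge u v : 0 < P u v -> P u v = (p u + 2 - p v)%:R / (S u)%:R.
  by rewrite /P; case: ifP; rewrite // ltxx.
have S_gt0 u : u \in U -> 0 < (S u)%:R :> R by move/S_gt; apply: lt_trans.
(* Where the weight is positive the subtraction is not truncated, so [p] telescopes. *)
have pathP_le x s : path (fun u v => 0 < P u v) x s ->
    pathw P x s <= (2 * (size s)%:R + (p x)%:R - (p (last x s))%:R) / Lam.
  elim: s x => [|y s IH] x /=; first by rewrite mulr0 add0r subrr mul0r.
  case/andP=> Pxy /IH le_s; rewrite (P_edge _ _ Pxy).
  have [xU yU xy q0] := P_pos _ _ Pxy.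
  have qE : (p x + 2 - p y)%:R = (p x)%:R + 2 - (p y)%:R :> R.
    by rewrite natrB ?natrD // ltnW // -subn_gt0.
  have : (p x + 2 - p y)%:R / (S x)%:R <= (p x + 2 - p y)%:R / Lam.
    by rewrite ler_wpM2l // lef_pV2 ?posrE ?S_gt0 // ltW // S_gt.
  move=> le1; apply: le_trans (lerD le1 le_s) _.
  rewrite -mulrDl ler_pM2r ?invr_gt0 // qE -[(size s).+1]addn1 natrD; lra.
(* Then [expR (lam / 2)] is the tenth power of [Delta], ample for both growth conditions of
   [heavy_cycle]. *)
pose lam : R := 20 * ln Delta%:R.
have lam_gt0 : 0 < lam by rewrite mulr_gt0.
have D_gt0 : 0 < Delta%:R :> R by lra.
have expE : expR (lam / 2) = Delta%:R ^+ 10.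
  rewrite (_ : lam / 2 = 10%:R * ln Delta%:R); last by rewrite /lam; field.
  by rewrite expRM_natl lnK ?posrE.
have D8 : 256 <= Delta%:R ^+ 8 :> R.
  by rewrite (_ : 256 = 2 ^+ 8) ?lerXn2r ?nnegrE //; ring.
have D10 : 256 * Delta%:R ^+ 2 <= Delta%:R ^+ 10 :> R.
  by rewrite (_ : 10 = 8 + 2)%N // exprD ler_wpM2r // exprn_ge0.
have lnD_le : ln Delta%:R <= Delta%:R :> R.
  by have := le_ln1Dx (x := Delta%:R - 1 : R); rewrite subrKC; lra.
have [] := @heavy_cycle R G P U lam (2 * Delta%:R)^-1 Delta%:R => //.
- by move=> x; rewrite /P edge_irr !andbF.
- move=> x xU; rewrite /P -big_mkcond /= -mulr_suml.
  rewrite (eq_bigl (fun y => (y \in U) && edge x y)); last by move=> y; rewrite xU.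
  by rewrite -natr_sum divff // gt_eqF // S_gt0.
- by move=> x y _ /P_pos[].
- move=> x y Pxy; have [xU _ _ q0] := P_pos _ _ Pxy; rewrite P_edge //.
  apply: (@le_trans _ _ ((S x)%:R^-1)).
    by rewrite lef_pV2 ?posrE ?mulr_gt0 ?S_gt0 // S_le.
  by rewrite ler_peMl ?invr_ge0 // ler1n.
(* Each numerator is a summand of [S x], so entries are at most 1. *)
- move=> y; apply: (@le_trans _ _ (indeg y)%:R); last by rewrite ler_nat.
  rewrite /indeg -sum1dep_card natr_sum [leRHS]big_mkcond; apply: ler_sum => x _.
  rewrite /P; case: ifP => [/and3P[xU yU xy]|_]; last by case: ifP.
  rewrite xy ler_pdivrMr ?S_gt0 // mul1r ler_nat.
  by rewrite /S (bigD1 y) ?yU //= leq_addr.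
- rewrite expE (_ : 2 * (2 * Delta%:R)^-1 = Delta%:R^-1); last by field; rewrite gt_eqF.
  by rewrite ler_pdivlMl // -expr2; nra.
- rewrite expE /lam; nra.
move=> r [s [prs urs heavy]].
have cyc : dicycle (r :: s).
  rewrite /dicycle urs /=; apply: sub_path prs => x y; by case/P_pos.
have := short _ cyc; have := le_trans heavy (pathP_le _ _ prs).
rewrite last_rcons size_rcons addrK /lam ler_pdivlMr //.
rewrite -[X in X * Lam]div1r mulrAC ler_pdivrMr ?mulr_gt0 //=; lra.
Qed.
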